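(* There is an absolute constant $C>0$ such that for every $n$ and every graph $H\subseteq K_n$ with at least one edge, the uniform probability measure $\nu_H$ on the copies of $H$ in $K_n$ is $Cq_H\log(2e(H))$-spread.
   Context: All graphs are finite and simple; $e(G)$ is the number of edges of $G$. A graph is nonempty if it has at least one edge. Isolated vertices are omitted, so a subgraph is identified with its edge set together with the endpoints of these edges; subgraphs need not be induced or connected. Logarithms are natural. A copy of $H$ in $K_n$ is a subgraph of $K_n$ isomorphic to $H$, and $N_I(G)$ denotes the number of copies of $I$ in $G$ (subgraphs of $G$ isomorphic to $I$). $\nu_H$ is the uniform probability measure on the copies of $H$ in $K_n$. For nonempty $H\subseteq K_n$, $$q_H:=\max_{\varnothing\ne I\subseteq H}N_I(K_n)^{-1/e(I)},$$ the maximum being over all nonempty subgraphs $I$ of $H$. A probability measure $\mu$ on subgraphs of $K_n$ is $a$-spread if $\mu(\{S:A\subseteq E(S)\})\le a^{|A|}$ for every nonempty edge set $A\subseteq E(K_n)$. *)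

(* Defs.v *)
From HB Require Import structures.
From mathcomp Require Import all_boot all_order all_algebra.
From mathcomp Require Import reals exp.

Set Implicit Arguments.
Unset Strict Implicit.
Unset Printing Implicit Defensive.

Import Order.TTheory GRing.Theory Num.Theory.
Local Open Scope ring_scope.

(* A graph without isolated vertices is its set of edges, an edge being a
   two-element set of vertices.  Thus [e(G)] is [#|G|], subgraph inclusion is
   [\subset], and the vertex set of [G] is [cover G], the union of its edges.
   A set [G : {set {set T}}] is a (simple) graph iff [G \subset complete T];
   the graph K_n is [complete 'I_n]. *)
Definition complete (T : finType) : {set {set T}} := [set e : {set T} | #|e| == 2%N].

(* Only the values of [f] on the vertex set [cover G] matter. *)
Definition graph_iso (T : finType) (G G' : {set {set T}}) : bool :=
  [exists f : {ffun T -> T},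
    [&& dinjectiveb f (mem (cover G)),
        f @: cover G == cover G' &
        [forall u in cover G, forall v in cover G,
           ([set u; v] \in G) == ([set f u; f v] \in G')]]].

Definition copies (T : finType) (I G : {set {set T}}) : {set {set {set T}}} :=
  [set S : {set {set T}} | (S \subset G) && graph_iso I S].

Definition num_copies (T : finType) (I G : {set {set T}}) : nat :=
  #|copies I G|.

(* The default value 0 of the maximum is harmless: every term is positive, and
   there is at least one term when [H] is nonempty. *)
Definition qH (R : realType) (n : nat) (H : {set {set 'I_n}}) : R :=
  \big[Num.max/0]_(I : {set {set 'I_n}} | (I \subset H) && (I != set0))
    ((num_copies I (complete 'I_n))%:R `^ (- (#|I|%:R)^-1)).

(* Probability measures on a finite type, given by their point masses. *)
Record fprob (R : realType) (T : finType) := FProb {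
  mass :> T -> R;
  mass_ge0 : forall x, 0 <= mass x;
  mass_sum1 : \sum_x mass x = 1 }.

Definition Pr (R : realType) (T : finType) (mu : fprob R T) (P : pred T) : R :=
  \sum_(x | P x) mu x.

Section Uniform.
Variables (R : realType) (T : finType) (A : {set T}) (A_neq0 : A != set0).

Definition uniform_mass (x : T) : R := if x \in A then (#|A|%:R)^-1 else 0.

Lemma uniform_mass_ge0 x : 0 <= uniform_mass x.
Proof. by rewrite /uniform_mass; case: ifP => // _; rewrite invr_ge0 ler0n. Qed.

Lemma uniform_mass_sum1 : \sum_x uniform_mass x = 1.
Proof.
rewrite -big_mkcond /= sumr_const -[LHS]mulr_natr mulVf //.
by rewrite pnatr_eq0 cards_eq0.
Qed.

Definition uniform_on : fprob R T := FProb uniform_mass_ge0 uniform_mass_sum1.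

End Uniform.

Lemma graph_iso_refl (T : finType) (G : {set {set T}}) : graph_iso G G.
Proof.
apply/existsP; exists [ffun x => x]; apply/and3P; split.
- by apply/dinjectiveP => x y _ _; rewrite !ffunE.
- apply/eqP/setP => x; apply/imsetP/idP => [[y yG ->]|xG]; first by rewrite ffunE.
  by exists x => //; rewrite ffunE.
- by apply/forall_inP => u _; apply/forall_inP => v _; rewrite !ffunE.
Qed.

Lemma copies_neq0 (T : finType) (H G : {set {set T}}) :
  H \subset G -> copies H G != set0.
Proof. by move=> HG; apply/set0Pn; exists H; rewrite inE HG graph_iso_refl. Qed.

Definition nu (R : realType) (n : nat) (H : {set {set 'I_n}})
    (HK : H \subset complete 'I_n) : fprob R {set {set 'I_n}} :=
  uniform_on R (copies_neq0 HK).

Definition spread (R : realType) (n : nat) (a : R)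
    (mu : fprob R {set {set 'I_n}}) : Prop :=
  forall A : {set {set 'I_n}}, A \subset complete 'I_n -> A != set0 ->
    Pr mu [pred S : {set {set 'I_n}} | A \subset S] <= a ^+ #|A|.

(* Main.v *)
(* Let a finite group act on a finite set, and let P(A <= G) be the probability
   that a uniformly random translate of A lies in G; for permutations acting on
   edges this is nu_G(A), and P(I <= I) = 1 / N_I(K_n).  Let l be about
   log |H|, and choose A and G <= H maximizing P(A <= G)^(l/|A|) / |G|.  With
   a = P(A <= G)^(1/|A|), every B has P(B <= H) <= (2a)^|B| and
   P(B <= G) <= a^|B|, and each element of G lies in a proportion at least
   about |A| / (l |G|) of the translates of A inside G.

   Take N / |A| independent random translates of A, with N about 2 l |G|.  Given
   that all of them lie in G, their union W contains at least half of G with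
   probability at least 1/2.  On the other hand, for a fixed I <= G, by symmetry
   P(W = I) is P(I <= I) times the probability that W is a translate of I.
   Revealing the translates one by one, each overlap with the previous ones is
   controlled by P(B <= G) <= a^|B|, so the latter probability is at most
   e^(O(|G|)) a^N (l/a)^|I|.  As P(I <= I) <= q^|I|, summing over the at most
   2^|G| sets I with |I| >= |G| / 2 forces a = O(l q). *)

Require Import Defs.
From mathcomp Require Import all_boot all_order all_algebra.
From mathcomp Require Import reals exp.
From mathcomp Require Import all_fingroup sequences ring lra.

Set Implicit Arguments.
Unset Strict Implicit.
Unset Printing Implicit Defensive.

Import Order.TTheory GRing.Theory Num.Theory.
Local Open Scope ring_scope.

Lemma sum_powerset_exp (R : comPzRingType) (X : finType) (A : {set X}) (u : R) :
  \sum_(B : {set X} | B \subset A) u ^+ #|B| = (1 + u) ^+ #|A|.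
Proof.
transitivity (\prod_x ((if x \in A then u else 0) + 1)); last first.
  rewrite (bigID (mem A)) /= [X in _ * X]big1 ?mulr1; last first.
    by move=> x /negbTE ->; rewrite add0r.
  rewrite (eq_bigr (fun=> 1 + u)) ?prodr_const // => x ->.
  by rewrite addrC.
rewrite bigA_distr /= big_mkcond /=; apply: eq_bigr => B _.
case: ifP => [sBA|/negbT /subsetPn [x xB xA]]; last first.
  by rewrite (bigD1 x) //= xB (negbTE xA) mul0r.
rewrite -prodr_const big_mkcond /=; apply: eq_bigr => x _.
by case: ifP => // xB; rewrite (subsetP sBA).
Qed.

(** * Averages over a finite group *)

Section GroupMean.
Variables (R : realType) (gT : finGroupType).
Implicit Types F K : gT -> R.

Definition gmean F : R := (\sum_g F g) / #|gT|%:R.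

Lemma card_group_gt0 : 0 < #|gT|%:R :> R.
Proof. by rewrite ltr0n; apply/card_gt0P; exists 1%g. Qed.

Lemma eq_gmean F K : F =1 K -> gmean F = gmean K.
Proof. by move=> eqFK; rewrite /gmean (eq_bigr _ (fun g _ => eqFK g)). Qed.

Lemma le_gmean F K : (forall g, F g <= K g) -> gmean F <= gmean K.
Proof.
by move=> leFK; rewrite ler_pM2r ?invr_gt0 ?card_group_gt0 // ler_sum.
Qed.

Lemma gmean_cst c : gmean (fun=> c) = c.
Proof.
rewrite /gmean sumr_const -[c *+ _]mulr_natr mulfK //.
by rewrite gt_eqF ?card_group_gt0.
Qed.

Lemma gmeanZ c F : gmean (fun g => c * F g) = c * gmean F.
Proof. by rewrite /gmean -mulr_sumr mulrA. Qed.

Lemma gmean_sum (I : finType) (P : pred I) (F : I -> gT -> R) :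
  gmean (fun g => \sum_(i | P i) F i g) = \sum_(i | P i) gmean (F i).
Proof. by rewrite /gmean exchange_big mulr_suml. Qed.

Lemma gmeanMr F h : gmean (fun g => F (g * h)%g) = gmean F.
Proof. by rewrite /gmean [in RHS](reindex_inj (mulIg h)). Qed.

Lemma gmeanV F : gmean (fun g => F g^-1%g) = gmean F.
Proof. by rewrite /gmean [in RHS](reindex_inj invg_inj). Qed.

End GroupMean.

(** * Random translates, their unions and their overlaps *)

Section Translates.
Variables (R : realType) (gT : finGroupType) (X : finType).
Variable to : {action gT &-> X}.
Implicit Types (A B G W I : {set X}) (phi psi : {set X} -> R).

Local Notation tr := (to^* )%act.

Lemma trE A g : tr A g = [set to x g | x in A].
Proof. by []. Qed.

Lemma trU A B g : tr (A :|: B) g = tr A g :|: tr B g.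
Proof. by rewrite !trE imsetU. Qed.

Lemma trI A B g : tr (A :&: B) g = tr A g :&: tr B g.
Proof. by rewrite !trE imsetI // => x y _ _; apply: act_inj. Qed.

Lemma trS A B g : (tr A g \subset tr B g) = (A \subset B).
Proof.
rewrite !trE; apply/idP/idP => [sAB|]; last exact: imsetS.
apply/subsetP => x xA; have := subsetP sAB _ (imset_f (to^~ g) xA).
by case/imsetP => y yB /act_inj ->.
Qed.

Lemma tr0 g : tr set0 g = set0.
Proof. by rewrite trE imset0. Qed.

Definition hit_prob A G : R := gmean (fun g => (tr A g \subset G)%:R).

Lemma hit_prob_ge0 A G : 0 <= hit_prob A G.
Proof. by rewrite -(gmean_cst gT (0 : R)) le_gmean // => g; rewrite ler0n. Qed.

Lemma hit_prob_set0l G : hit_prob set0 G = 1.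
Proof.
rewrite -(gmean_cst gT (1 : R)); apply: eq_gmean => g.
by rewrite tr0 sub0set.
Qed.

Lemma hit_prob_set0r A : A != set0 -> hit_prob A set0 = 0.
Proof.
move=> A0; rewrite -(gmean_cst gT (0 : R)); apply: eq_gmean => g.
by rewrite subset0 -cards_eq0 card_setact cards_eq0 (negbTE A0).
Qed.

Lemma hit_prob_subr A G W : G \subset W -> hit_prob A G <= hit_prob A W.
Proof.
move=> sGW; apply: le_gmean => g; rewrite ler_nat.
by case: (boolP (tr A g \subset G)) => // /subset_trans/(_ sGW) ->.
Qed.

Lemma hit_prob_tr A G h : hit_prob A (tr G h) = hit_prob A G.
Proof.
rewrite -[LHS](gmeanMr _ h); apply: eq_gmean => g.
by rewrite actM trS.
Qed.

(* [iter r (add_translate A) phi W] is the expectation of [phi] at the union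
   of [W] with [r] independent uniformly random translates of [A]. *)
Definition add_translate A phi W : R := gmean (fun g => phi (W :|: tr A g)).

Local Notation T A r := (iter r (add_translate A)).

Lemma le_iterT A r phi psi : (forall W, phi W <= psi W) ->
  forall W, T A r phi W <= T A r psi W.
Proof.
by move=> le; elim: r => [|r IH] W //=; apply: le_gmean => g.
Qed.

Lemma eq_iterT A r phi psi : phi =1 psi -> T A r phi =1 T A r psi.
Proof.
by move=> e; elim: r => [|r IH] W //=; apply: eq_gmean => g.
Qed.

Lemma iterTZ A r c phi W : T A r (fun W => c * phi W) W = c * T A r phi W.
Proof.
elim: r W => [|r IH] W //=; rewrite -gmeanZ.
exact: eq_gmean.
Qed.

Lemma iterT_sum A r (J : finType) (P : pred J) (phi : J -> {set X} -> R) W :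
  T A r (fun W => \sum_(i | P i) phi i W) W = \sum_(i | P i) T A r (phi i) W.
Proof.
elim: r W => [|r IH] W //=; rewrite -gmean_sum.
exact: eq_gmean.
Qed.

Lemma iterTD A r phi psi W :
  T A r (fun W => phi W + psi W) W = T A r phi W + T A r psi W.
Proof.
transitivity (T A r (fun W => \sum_(b : bool) (if b then phi W else psi W)) W).
  by apply: eq_iterT => V; rewrite big_bool.
by rewrite iterT_sum big_bool.
Qed.

Lemma iterT_tr A r phi h W :
  T A r (fun W => phi (tr W h)) W = T A r phi (tr W h).
Proof.
elim: r W => [|r IH] W //=.
rewrite -[RHS](gmeanMr _ h); apply: eq_gmean => g.
by rewrite IH trU actM.
Qed.

Lemma iterT_sub A r G W :
  T A r (fun W => (W \subset G)%:R) W = (W \subset G)%:R * hit_prob A G ^+ r.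
Proof.
elim: r W => [|r IH] W /=; first by rewrite mulr1.
rewrite -[RHS]mulrC exprS -mulrA [X in _ * X]mulrC mulrC -gmeanZ.
apply: eq_gmean => g; rewrite IH subUset.
by case: (W \subset G); case: (tr A g \subset G); rewrite ?mulr1 ?mul1r ?mulr0 ?mul0r.
Qed.

(** If [W = tr I h], replacing [g] by [g * h] turns the event into [tr I g = I], which implies
    [tr I g \subset I]; otherwise the mean is 0. *)
Lemma gmean_eq_tr I W :
  gmean (fun g => (W == tr I g)%:R) <=
  hit_prob I I * ([exists g, W == tr I g])%:R.
Proof.
case: existsP => [[h /eqP ->]|noh]; last first.
  rewrite mulr0 -(gmean_cst gT (0 : R)); apply: le_gmean => g.
  by case: eqP => // e; case: noh; exists g; apply/eqP.
rewrite mulr1 /hit_prob -[X in X <= _](gmeanMr _ h); apply: le_gmean => g.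
rewrite actM ler_nat; case: eqP => // /(can_inj (actK _ _)) <-.
by rewrite subxx.
Qed.

(** Expand the power over the subsets [B] of [A] with [tr B g \subset W]. Each term has mean at most
    [(u / a) ^+ #|B| * a ^+ #|B|], and the powers of [u] sum back to the right-hand side. *)
Lemma gmean_exp_overlap A W (a u : R) : 0 < a -> 0 <= u ->
  (forall B, hit_prob B W <= a ^+ #|B|) ->
  gmean (fun g => (1 + u / a) ^+ #|W :&: tr A g|) <= (1 + u) ^+ #|A|.
Proof.
move=> a0 u0 hW.
have E g : (1 + u / a) ^+ #|W :&: tr A g| =
    \sum_(B : {set X} | B \subset A) (u / a) ^+ #|B| * (tr B g \subset W)%:R.
  have -> : #|W :&: tr A g| = #|A :&: tr W g^-1%g|.
    by rewrite -[RHS](card_setact to _ g) trI actKV setIC.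
  rewrite -sum_powerset_exp big_mkcond [RHS]big_mkcond /=.
  apply: eq_bigr => B _; rewrite subsetI.
  rewrite -[tr B g \subset W](trS _ _ g^-1%g) actK.
  by case: (B \subset A); case: (B \subset _); rewrite ?mulr1 ?mulr0.
rewrite (eq_gmean E) gmean_sum -sum_powerset_exp; apply: ler_sum => B _.
rewrite gmeanZ -/(hit_prob B W).
apply: (le_trans (ler_wpM2l _ (hW B))); first by rewrite exprn_ge0 // divr_ge0 // ltW.
by rewrite -exprMn divfK // gt_eqF.
Qed.

(** Since [tr B g \subset W] iff [B \subset tr W g^-1], this says that a uniformly random translate
    of [W] is [a]-spread. *)
Definition hit_le (a : R) W := [forall B, hit_prob B W <= a ^+ #|B|].

(* Exponential-moment form of the bound on the number of ways in which [r]
   translates can overlap inside translates of a set that is [a]-spread. *)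
Lemma iterT_exp A r (a u : R) W : 0 < a -> 0 <= u ->
  T A r (fun W => (hit_le a W)%:R * (1 + u / a) ^- #|W|) W <=
  (hit_le a W)%:R * (1 + u / a) ^- #|W| *
    ((1 + u / a) ^- #|A| * (1 + u) ^+ #|A|) ^+ r.
Proof.
move=> a0 u0; set z := 1 + u / a.
have z0 : 0 < z by rewrite /z ltr_pwDl // divr_ge0 // ltW.
elim: r W => [|r IH] W /=; first by rewrite mulr1.
set c := _ * _ ^+ #|A|.
have c0 : 0 <= c by rewrite mulr_ge0 ?invr_ge0 ?exprn_ge0 ?(ltW z0) // addr_ge0.
apply: (@le_trans _ _ (gmean (fun g => (hit_le a W)%:R * z ^- #|W| * c ^+ r *
    z ^- #|A| * z ^+ #|W :&: tr A g|))).
  apply: le_gmean => g; apply: (le_trans (IH _)).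
  have -> : (hit_le a W)%:R * z ^- #|W| * c ^+ r * z ^- #|A| * z ^+ #|W :&: tr A g| =
     (hit_le a W)%:R * (z ^- #|W| * z ^- #|A| * z ^+ #|W :&: tr A g|) * c ^+ r.
    by ring.
  rewrite ler_wpM2r ?exprn_ge0 //.
  have -> : z ^- #|W| * z ^- #|A| * z ^+ #|W :&: tr A g| = z ^- #|W :|: tr A g|.
    have := cardsUI W (tr A g); rewrite card_setact => e.
    rewrite -invfM -exprD -e exprD invfM mulfVK // expf_eq0 andbC.
    by rewrite gt_eqF.
  rewrite ler_wpM2r ?invr_ge0 ?exprn_ge0 ?(ltW z0) // ler_nat.
  (* The condition passes to subsets, so [hit_le] at the union gives it at [W], where the overlap
     bound is applied. *)
  case: (boolP (hit_le a (_ :|: _))) => // /forallP H.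
  suff -> : hit_le a W by [].
  by apply/forallP => B; apply: le_trans (H B); rewrite hit_prob_subr // subsetUl.
rewrite gmeanZ exprSr.
case: (boolP (hit_le a W)) => [/forallP gW|_]; last by rewrite !mul0r.
rewrite -!mulrA !ler_wpM2l ?ler0n ?invr_ge0 ?exprn_ge0 ?(ltW z0) //.
exact: gmean_exp_overlap.
Qed.

Lemma hit_le_tr a W h : hit_le a (tr W h) = hit_le a W.
Proof. by apply: eq_forallb => B; rewrite hit_prob_tr. Qed.

(** The law of the union is translation invariant, so [I] may be replaced by a random translate of
    [I]. If the union is such a translate, it satisfies [hit_le a] and has [#|I|] elements, so the
    weight of [iterT_exp] times [(1 + u / a) ^+ #|I|] is 1. *)
Lemma iterT_eq A I r (a u : R) : 0 < a -> 0 <= u -> hit_le a I ->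
  T A r (fun W => (W == I)%:R) set0 <=
  hit_prob I I * (1 + u / a) ^+ #|I| *
    ((1 + u / a) ^- #|A| * (1 + u) ^+ #|A|) ^+ r.
Proof.
move=> a0 u0 hI.
have z0 : 0 < 1 + u / a by rewrite ltr_pwDl // divr_ge0 // ltW.
have -> : T A r (fun W => (W == I)%:R) set0 =
    T A r (fun W => gmean (fun g => (W == tr I g)%:R)) set0.
  transitivity (T A r (fun W => #|gT|%:R^-1 * \sum_g (W == tr I g)%:R) set0).
    rewrite iterTZ iterT_sum mulrC -[LHS](gmean_cst gT); apply: eq_gmean => g.
    rewrite -[in LHS](tr0 g^-1%g) -iterT_tr; apply: eq_iterT => W.
    by rewrite (can2_eq (actKV _ g) (actK _ g)).
  by apply: eq_iterT => W; rewrite mulrC.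
set c := hit_prob I I * _.
have c0 : 0 <= c by rewrite mulr_ge0 ?hit_prob_ge0 ?exprn_ge0 // ltW.
apply: (@le_trans _ _ (T A r
    (fun W => c * ((hit_le a W)%:R * (1 + u / a) ^- #|W|)) set0)).
  apply: le_iterT => W; apply: le_trans (gmean_eq_tr I W) _.
  case: existsP => [[g /eqP ->]|_]; last first.
    by rewrite mulr0 mulr_ge0 // mulr_ge0 ?ler0n ?invr_ge0 ?exprn_ge0 ?(ltW z0).
  rewrite hit_le_tr hI card_setact mul1r mulr1 /c mulfK // expf_eq0 andbC.
  by rewrite gt_eqF.
rewrite iterTZ ler_wpM2l //.
apply: le_trans (iterT_exp _ _ _ a0 u0) _.
rewrite cards0 expr0 invr1 mulr1 ler_piMl ?lern1 ?leq_b1 //.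
by rewrite exprn_ge0 // mulr_ge0 ?invr_ge0 ?exprn_ge0 ?(ltW z0) // addr_ge0.
Qed.

(** * Hitting rates and the extremal pair *)

Definition hit_rate A G : R := hit_prob A G `^ (#|A|%:R)^-1.

Lemma hit_rateX A G : A != set0 -> hit_rate A G ^+ #|A| = hit_prob A G.
Proof.
move=> A0; rewrite -powR_mulrn ?powR_ge0 // -powRrM mulVf ?powRr1 ?hit_prob_ge0 //.
by rewrite pnatr_eq0 cards_eq0.
Qed.

Lemma hit_prob_refl_gt0 A : 0 < hit_prob A A.
Proof.
rewrite divr_gt0 ?card_group_gt0 //.
by rewrite (bigD1 1%g) //= act1 subxx ltr_pwDl // sumr_ge0.
Qed.

(* Maximizing [hit_rate A G ^+ l / #|G|] over both [A] and [G] makes [A] the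
   worst set for [G], while every element of [G] is in a proportion at least
   about [#|A| / (l * #|G|)] of the translates of [A] inside [G]. *)
Lemma extremal_pair (H : {set X}) (l : nat) : H != set0 -> (#|H| <= 2 ^ l)%N ->
  (0 < l)%N ->
  exists A G (a : R), [/\ A != set0, G \subset H /\ G != set0, 0 < a,
    hit_prob A G = a ^+ #|A| /\ hit_le a G &
    (forall e, e \in G ->
      hit_prob A (G :\ e) ^+ l <= (a ^+ l * (1 - #|G|%:R^-1)) ^+ #|A|) /\
    (forall B, hit_prob B H <= (2 * a) ^+ #|B|)].
Proof.
move=> H0 Hl l0.
pose P (p : {set X} * {set X}) := [&& p.1 != set0, p.2 != set0 & p.2 \subset H].
pose F (p : {set X} * {set X}) := hit_rate p.1 p.2 ^+ l / #|p.2|%:R.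
have PH : P (H, H) by rewrite /P /= H0 subxx.
have [[A G] /= /and3P [/= A0 G0 GH] Fmax] := @arg_maxP _ _ _ (H, H) P F PH.
have cardP W : W != set0 -> 0 < #|W|%:R :> R by rewrite ltr0n card_gt0.
have rate0 B W : 0 <= hit_rate B W by rewrite powR_ge0.
have max B W : B != set0 -> W != set0 -> W \subset H ->
    hit_rate B W ^+ l / #|W|%:R <= hit_rate A G ^+ l / #|G|%:R.
  by move=> B0 W0 WH; apply: (Fmax (B, W)); rewrite /P /= B0 W0 WH.
exists A, G, (hit_rate A G); split => //.
- rewrite lt_neqAle rate0 andbT eq_sym; apply/eqP => e.
  have := max H H H0 H0 (subxx _).
  rewrite e expr0n eqn0Ngt l0 mul0r leNgt divr_gt0 ?cardP // exprn_gt0 //.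
  by rewrite powR_gt0 // hit_prob_refl_gt0.
- split; first by rewrite hit_rateX.
  apply/forallP => B; have [->|B0] := eqVneq B set0.
    by rewrite cards0 expr0 hit_prob_set0l.
  rewrite -hit_rateX // lerXn2r ?nnegrE //.
  have := max B G B0 G0 GH; rewrite ler_pM2r ?invr_gt0 ?cardP //.
  by rewrite ler_pXn2r ?nnegrE.
- split=> [e eG|B]; last first.
    have [->|B0] := eqVneq B set0; first by rewrite cards0 expr0 hit_prob_set0l.
    rewrite -hit_rateX // lerXn2r ?nnegrE ?mulr_ge0 //.
    rewrite -(ler_pXn2r l0) ?nnegrE ?mulr_ge0 // exprMn.
    (* Comparison with [(B, H)] costs a factor [#|H| / #|G| <= 2 ^ l], whose [l]-th root is at most
       2. *)
    have := max B H B0 H0 (subxx _); rewrite ler_pdivrMr ?cardP // => le.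
    apply: (le_trans le); rewrite mulrC ler_pM ?divr_ge0 ?exprn_ge0 //.
      by rewrite -natrX ler_nat.
    rewrite ler_pdivrMr ?cardP // ler_peMr ?exprn_ge0 //.
    by rewrite ler1n card_gt0.
  have GE : #|G|%:R = #|G :\ e|%:R + 1 :> R by rewrite (cardsD1 e G) eG natrD addrC.
  have -> : 1 - #|G|%:R^-1 = #|G :\ e|%:R / #|G|%:R :> R.
    by rewrite -[X in X - _](divff (lt0r_neq0 (cardP _ G0))) -[X in _ - X]mul1r -mulrBl GE addrK.
  (* The empty set is excluded from the maximum, but no translate of [A] fits in it. *)
  have [e0|Ge0] := eqVneq (G :\ e) set0.
    rewrite e0 hit_prob_set0r // expr0n eqn0Ngt l0 /=.
    by rewrite exprn_ge0 // mulr_ge0 ?exprn_ge0 // mulr_ge0 ?invr_ge0.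
  rewrite -(hit_rateX _ A0) exprAC lerXn2r ?nnegrE ?exprn_ge0 //.
    by rewrite mulr_ge0 ?exprn_ge0 // mulr_ge0 ?invr_ge0.
  have := max A _ A0 Ge0 (subset_trans (subsetDl _ _) GH).
  by rewrite ler_pdivrMr ?cardP // mulrAC mulrA.
Qed.

End Translates.

(** * Bounding the rate through the union of many translates *)

Section RateBound.
Variables (R : realType) (gT : finGroupType) (X : finType).
Variable to : {action gT &-> X}.
Implicit Types (A B G W I : {set X}).

(** From [1 + x <= expR x]: at [x = - E^-1] it bounds the [E]-th power by [1 / e], and at [x = 1] it
    gives [e >= 2]. *)
Lemma small_miss (E : nat) : (0 < E)%N ->
  (1 - E%:R^-1 : R) ^+ (2 * E) <= 4^-1.
Proof.
move=> E0.
have E1 : 1 <= E%:R :> R by rewrite ler1n.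
have b0 : 0 <= 1 - E%:R^-1 :> R by rewrite subr_ge0 invf_le1 // (lt_le_trans ltr01).
suff h : (1 - E%:R^-1 : R) ^+ E <= 2^-1.
  rewrite mulnC exprM -[4]/(2 * 2)%:R natrM invfM expr2.
  by rewrite ler_pM // exprn_ge0.
apply: (@le_trans _ _ (expR (- E%:R^-1) ^+ E)).
  by rewrite lerXn2r ?nnegrE ?expR_ge0 // expR_ge1Dx.
rewrite -expRM_natl mulrN divff ?gt_eqF ?(lt_le_trans ltr01) // expRN.
rewrite lef_pV2 ?posrE ?expR_gt0 //.
exact: (expR_ge1Dx 1).
Qed.

Lemma hit_le_subset (a : R) G W : W \subset G -> hit_le to a G -> hit_le to a W.
Proof.
move=> WG /forallP h; apply/forallP => B.
exact: le_trans (hit_prob_subr _ _ _ WG) (h B).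
Qed.

(* [expR 1 ^+ 3] bounds [(1 + l^-1) ^+ N] for [N <= 3 * l * E], and [8 = 2 * 4]
   absorbs the [2 ^ E] candidate unions with a factor [4 ^- E] to spare. *)
Definition rate_const : R := 8 * expR 1 ^+ 3.

Lemma rate_const_gt0 : 0 < rate_const.
Proof. by rewrite mulr_gt0 // exprn_gt0 // expR_gt0. Qed.

(** If the bound failed, the probability [a ^+ N] that the union lies in [G] would be at most
    [a ^+ N / 2], from unions missing over half of [G], plus [a ^+ N / 4], from the others. *)
Lemma rate_bound A G (a q : R) (l : nat) : (0 < l)%N -> A != set0 -> G != set0 ->
  0 < a -> 0 < q ->
  hit_prob R to A G = a ^+ #|A| -> hit_le to a G ->
  (forall e, e \in G ->
    hit_prob R to A (G :\ e) ^+ l <= (a ^+ l * (1 - #|G|%:R^-1)) ^+ #|A|) ->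
  (forall I, I \subset G -> I != set0 -> hit_prob R to I I <= q ^+ #|I|) ->
  a <= rate_const ^+ 2 * (l%:R * q).
Proof.
move=> l0 A0 G0 a0 q0 hAG hG hmiss hq; rewrite leNgt; apply/negP => small.
have K0 := rate_const_gt0; set K := rate_const in small K0.
set E := #|G| in hmiss.
have E0 : (0 < E)%N by rewrite card_gt0.
have ER : 0 < E%:R :> R by rewrite ltr0n.
have cA0 : (0 < #|A|)%N by rewrite card_gt0.
(* As [a ^+ #|A|] is positive, some translate of [A] lies in [G]. *)
have AE : (#|A| <= E)%N.
  have [/existsP [g sg]|no] := boolP [exists g, (to^* )%act A g \subset G].
    by have := subset_leq_card sg; rewrite card_setact.
  have : hit_prob R to A G = 0.
    rewrite -(gmean_cst gT (0 : R)); apply: eq_gmean => g.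
    by case: (boolP (_ \subset _)) => // sg; case/existsP: no; exists g.
  by rewrite hAG => /eqP; rewrite expf_eq0 gt_eqF // andbF.
(* With [l * s] translates, [hmiss] is used [s] times. Then [s * #|A| >= 2 * E] brings the miss
   factor down to 1/4, and [s * #|A| <= 3 * E] gives the cube in [rate_const]. *)
pose s := ((2 * E) %/ #|A|).+1.
have sA_ge : (2 * E <= s * #|A|)%N by rewrite ltnW // ltn_ceil.
have sA_le : (s * #|A| <= 3 * E)%N.
  by rewrite [leqRHS]mulSn [leqLHS]mulSn leq_add // leq_trunc_div.
pose M phi := iter (l * s) (add_translate to A) phi set0 : R.
pose N := (l * (s * #|A|))%N.
have EN : (E <= N)%N.
  apply: leq_trans (leq_pmull _ l0); apply: leq_trans sA_ge.
  by rewrite leq_pmull.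
have aN : 0 < a ^+ N by rewrite exprn_gt0.
have total : M (fun W => (W \subset G)%:R) = a ^+ N.
  by rewrite /M iterT_sub sub0set mul1r hAG -exprM /N mulnCA [(#|A| * _)%N]mulnC mulnA.
have miss e : e \in G -> M (fun W => (W \subset G :\ e)%:R) <= a ^+ N / 4.
  move=> eG; rewrite /M iterT_sub sub0set mul1r exprM.
  have b0 : 0 <= 1 - E%:R^-1 :> R by rewrite subr_ge0 invf_le1 // ler1n.
  have q_ge0 := hit_prob_ge0 R to A (G :\ e).
  apply: (@le_trans _ _ (((a ^+ l * (1 - E%:R^-1)) ^+ #|A|) ^+ s)).
    by rewrite lerXn2r ?nnegrE ?hmiss ?exprn_ge0 // mulr_ge0 ?exprn_ge0 // ltW.
  rewrite -exprM [(#|A| * s)%N]mulnC exprMn -exprM ler_wpM2l ?(ltW aN) //.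
  apply: le_trans (small_miss E0); rewrite ler_wiXn2l //.
  by rewrite lerBlDr lerDl invr_ge0 ltW.
have point I : I \subset G -> (E <= 2 * #|I|)%N ->
    M (fun W => (W == I)%:R) <= a ^+ N * (expR 1 ^+ 3 / K) ^+ E.
  move=> IG EI.
  have I0 : I != set0.
    by apply: contraTneq EI => ->; rewrite cards0 muln0 -ltnNge.
  have lR : 0 < l%:R :> R by rewrite ltr0n.
  have l_ge0 := ltW lR.
  have IN : (#|I| <= N)%N := leq_trans (subset_leq_card IG) EN.
  (* The choice [u = l] gives [(1 + u) ^+ N = l ^+ N * (1 + l^-1) ^+ N], whose last factor is at
     most [expR 1 ^+ (3 * E)]; the bound [z >= l / a] then cancels [l ^+ (N - #|I|)]. *)
  apply: (le_trans (iterT_eq _ _ a0 l_ge0 (hit_le_subset IG hG))).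
  set z := 1 + l%:R / a.
  have z0 : 0 < z by rewrite ltr_pwDl // divr_ge0 // ltW.
  have Ez : z ^+ #|I| * (z ^- #|A| * (1 + l%:R) ^+ #|A|) ^+ (l * s) =
      z ^- (N - #|I|) * (1 + l%:R) ^+ N.
    rewrite exprMn exprVn -!exprM.
    have -> : (#|A| * (l * s) = N)%N by rewrite mulnCA [(#|A| * _)%N]mulnC.
    rewrite mulrA; congr (_ * _).
    have -> : z ^+ N = z ^+ (N - #|I|) * z ^+ #|I| by rewrite -exprD subnK.
    by rewrite invfM mulrCA divff ?mulr1 // expf_neq0 // gt_eqF.
  rewrite -mulrA Ez.
  have zV : z ^- (N - #|I|) <= (a / l%:R) ^+ (N - #|I|).
    rewrite -exprVn lerXn2r ?nnegrE ?invr_ge0 ?(ltW z0) ?divr_ge0 ?(ltW a0) //.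
    by rewrite -[a / _]invf_div lef_pV2 ?posrE ?divr_gt0 // lerDr.
  have bound : hit_prob R to I I * (z ^- (N - #|I|) * (1 + l%:R) ^+ N) <=
      q ^+ #|I| * ((a / l%:R) ^+ (N - #|I|) * (1 + l%:R) ^+ N).
    rewrite ler_pM ?hit_prob_ge0 ?hq ?mulr_ge0 ?invr_ge0 ?exprn_ge0 ?addr_ge0 //.
      by rewrite divr_ge0 // ltW.
    by rewrite ler_wpM2r ?exprn_ge0 ?addr_ge0.
  apply: (le_trans bound).
  have -> : q ^+ #|I| * ((a / l%:R) ^+ (N - #|I|) * (1 + l%:R) ^+ N) =
      a ^+ N * ((l%:R * q / a) ^+ #|I| * (1 + l%:R^-1) ^+ N).
    have -> : 1 + l%:R = l%:R * (1 + l%:R^-1) :> R by rewrite mulrDr divff ?gt_eqF // mulr1 addrC.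
    have eN (x : R) : x ^+ N = x ^+ (N - #|I|) * x ^+ #|I| by rewrite -exprD subnK.
    rewrite !exprMn [a ^+ N]eN [l%:R ^+ N]eN !exprVn.
    by field; rewrite !expf_neq0 // gt_eqF.
  rewrite ler_wpM2l ?(ltW aN) // [leRHS]exprMn [leLHS]mulrC ler_pM ?exprn_ge0 ?addr_ge0 ?invr_ge0 //.
  - by rewrite divr_ge0 ?mulr_ge0 // ltW.
  - apply: (@le_trans _ _ (expR l%:R^-1 ^+ N)).
      by rewrite lerXn2r ?nnegrE ?addr_ge0 ?invr_ge0 ?expR_ge0 // expR_ge1Dx.
    rewrite /N exprM -expRM_natl divff ?gt_eqF // -exprM.
    by rewrite ler_weXn2l // ltW // expR_gt1.
  (* The negated bound and [E <= 2 * #|I|] together give [(l * q / a) ^+ #|I| <= K ^- E]. *)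
  have xK : l%:R * q / a <= K^-1 ^+ 2.
    rewrite ler_pdivrMr // exprVn ler_pdivlMl ?exprn_gt0 //; exact: ltW.
  apply: (@le_trans _ _ ((K^-1 ^+ 2) ^+ #|I|)).
    rewrite lerXn2r ?nnegrE //; first by rewrite divr_ge0 ?mulr_ge0 ?ltW.
    by rewrite exprn_ge0 // invr_ge0 ltW.
  rewrite -exprM ler_wiXn2l ?invr_ge0 ?(ltW K0) // invf_le1 //.
  rewrite -[1]mulr1 ler_pM // ?exprn_ege1 ?ler1n //.
  by rewrite ltW // expR_gt1.
(* Markov's inequality: the first sum counts the elements of [G] missed by [W], which exceed [E / 2]
   in number when [2 * #|W| < E]. *)
have split_W W : (W \subset G)%:R <=
    2 / E%:R * \sum_(e in G) (W \subset G :\ e)%:R +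
    \sum_(I : {set X} | (I \subset G) && (E <= 2 * #|I|)%N) (W == I)%:R :> R.
  have s1 : 0 <= \sum_(e in G) (W \subset G :\ e)%:R :> R by rewrite sumr_ge0.
  have s2 : 0 <= \sum_(I : {set X} | (I \subset G) && (E <= 2 * #|I|)%N) (W == I)%:R :> R.
    by rewrite sumr_ge0.
  have c0 : 0 <= 2 / E%:R :> R by rewrite divr_ge0 // ltW.
  have [WG|_] := boolP (W \subset G); last by rewrite addr_ge0 // mulr_ge0.
  have [EW|EW] := leqP E (2 * #|W|).
    apply: (@le_trans _ _ (0 + 1)); first by rewrite add0r.
    apply: lerD; first exact: mulr_ge0.
    by rewrite (bigD1 W) /= ?WG // eqxx lerDl sumr_ge0.
  rewrite -[X in X <= _]addr0 lerD //.
  have -> : \sum_(e in G) (W \subset G :\ e)%:R = #|G :\: W|%:R :> R.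
    rewrite -sum1_card natr_sum big_mkcond [RHS]big_mkcond /=.
    apply: eq_bigr => e _; rewrite inE subsetD1 WG /= andbC.
    by case: (e \in G); case: (e \in W).
  rewrite mulrAC ler_pdivlMr // mul1r -natrM ler_nat.
  rewrite cardsD (setIidPr WG) -/E mulnBr leq_subRL; last first.
    by rewrite leq_mul2l /= subset_leq_card.
  by rewrite [X in (_ <= X)%N]mul2n -addnn leq_add2r ltnW.
have : a ^+ N <= a ^+ N / 2 + a ^+ N / 4.
  rewrite -{1}total; apply: (le_trans (le_iterT _ _ _ split_W _)).
  rewrite iterTD iterTZ !iterT_sum; apply: lerD.
    apply: (@le_trans _ _ (2 / E%:R * \sum_(e in G) (a ^+ N / 4))).
      by rewrite ler_wpM2l ?divr_ge0 ?(ltW ER) // ler_sum.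
    rewrite sumr_const -/E -[X in _ * X]mulr_natl.
    rewrite le_eqVlt; apply/orP; left; apply/eqP; field; exact: lt0r_neq0.
  apply: (@le_trans _ _ (\sum_(I : {set X} | I \subset G)
            a ^+ N * (expR 1 ^+ 3 / K) ^+ E)).
    apply: (@le_trans _ _ (\sum_(I : {set X} | (I \subset G) && (E <= 2 * #|I|)%N)
            a ^+ N * (expR 1 ^+ 3 / K) ^+ E)).
      by apply: ler_sum => I /andP [IG EI]; apply: point.
    rewrite [X in _ <= X](bigID (fun I => (E <= 2 * #|I|)%N)) /= lerDl.
    rewrite sumr_ge0 // => I _; rewrite mulr_ge0 ?(ltW aN) // exprn_ge0 //.
    by rewrite divr_ge0 ?exprn_ge0 ?expR_ge0 // ltW.
  have -> : expR 1 ^+ 3 / K = 8^-1.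
    by rewrite /K /rate_const invfM mulrCA divff ?mulr1 // expf_neq0 // gt_eqF // expR_gt0.
  rewrite -mulr_sumr ler_wpM2l ?(ltW aN) //.
  rewrite sumr_const -[X in _ *+ X](cardsE) -/(powerset G).
  rewrite card_powerset -/E -[leLHS]mulr_natl natrX -exprMn.
  have -> : 2 * 8^-1 = 4^-1 :> R by field.
  by rewrite -[X in _ <= X]expr1 ler_wiXn2l ?invr_ge0 ?invf_le1 ?ler1n.
by move: aN; lra.
Qed.

Theorem hit_prob_le (H : {set X}) (q : R) : H != set0 -> 0 < q ->
  (forall I, I \subset H -> I != set0 -> hit_prob R to I I <= q ^+ #|I|) ->
  forall A, hit_prob R to A H <=
    (2 * rate_const ^+ 2 * (trunc_log 2 (2 * #|H|))%:R * q) ^+ #|A|.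
Proof.
move=> H0 q0 hq B; set l := trunc_log _ _.
have cH : (0 < #|H|)%N by rewrite card_gt0.
(* Doubling [#|H|] inside the logarithm gives [l >= 1] even for a singleton, and
   [2 * #|H| < 2 ^ l.+1] gives [#|H| <= 2 ^ l]. *)
have l0 : (0 < l)%N by rewrite trunc_log_gt0 /= -{1}[2%N]muln1 leq_mul2l.
have Hl : (#|H| <= 2 ^ l)%N.
  have := @trunc_log_ltn 2 (2 * #|H|) isT.
  by rewrite expnS ltn_pmul2l // => /ltnW.
have [A [G [a [A0 [GH G0] a0 [hAG hG] [hmiss hH]]]]] := extremal_pair R to H0 Hl l0.
apply: (le_trans (hH B)).
have hqG I : I \subset G -> I != set0 -> hit_prob R to I I <= q ^+ #|I|.
  by move=> IG; apply: hq; apply: subset_trans GH.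
have le_a : a <= rate_const ^+ 2 * (l%:R * q) by exact: rate_bound hAG hG hmiss hqG.
have a_ge0 := ltW a0.
have b_ge0 := le_trans a_ge0 le_a.
move: (rate_const ^+ 2) le_a b_ge0 => k le_a b_ge0.
rewrite -!mulrA; apply: lerXn2r; rewrite ?nnegrE.
- exact: mulr_ge0.
- exact: mulr_ge0.
- exact: ler_wpM2l.
Qed.

End RateBound.

(** * Copies of a graph as an orbit of the symmetric group *)

Section GraphCopies.
Variable n : nat.
Implicit Types (A I H S : {set {set 'I_n}}).

Definition perm_graph : {action 'S_n &-> {set 'I_n}} := ('P^*)%act.

Local Notation tr := (perm_graph^* )%act.

(** Induction along an enumeration of [D]: the transposition of [g x] and [f x] corrects the value
    at [x] and, by injectivity, moves none of the values already fixed. *)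
Lemma perm_extend (D : {set 'I_n}) (f : 'I_n -> 'I_n) :
  {in D &, injective f} -> exists g : 'S_n, {in D, f =1 g}.
Proof.
move=> injf; suff [g Hg] : exists g : 'S_n, {in enum D, f =1 g}.
  by exists g => x xD; rewrite Hg // mem_enum.
have : {subset enum D <= D} by move=> x; rewrite mem_enum.
elim: (enum D) (enum_uniq D) => [_ _|x s IH /= /andP [xs us] sD]; first by exists 1%g.
have [y ys|g Hg] := IH us; first by rewrite sD // inE ys orbT.
exists (g * tperm (g x) (f x))%g => y; rewrite inE permM => /predU1P [->|ys].
  by rewrite tpermL.
rewrite (Hg y ys) tpermD //; first by rewrite (inj_eq perm_inj); apply: contraNneq xs => ->.
rewrite -(Hg y ys); apply: contraNneq xs => e.
by rewrite (injf x y) // sD // inE ?eqxx ?ys ?orbT.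
Qed.

Lemma trE_perm I (g : 'S_n) : tr I g = [set g @: (e : {set 'I_n}) | e in I].
Proof. by []. Qed.

Lemma mem_cover I (e : {set 'I_n}) x : e \in I -> x \in e -> x \in cover I.
Proof. by move=> eI xe; apply/bigcupP; exists e. Qed.

(** An isomorphism is injective only on [cover I], so it is first extended to a permutation; all
    edges have their endpoints in the covers, where the two maps agree. *)
Lemma graph_iso_orbit I S : I \subset complete 'I_n ->
  (S \in copies I (complete 'I_n)) = (S \in orbit (perm_graph^*)%act setT I).
Proof.
move=> IK; rewrite inE.
have edge (G : {set {set 'I_n}}) e : G \subset complete 'I_n -> e \in G ->
    exists u v, e = [set u; v] /\ u \in cover G /\ v \in cover G.
  move=> GK eG; have := subsetP GK e eG; rewrite inE => /cards2P [u [v [_ euv]]].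
  exists u, v; split => //.
  by split; apply: (mem_cover eG); rewrite euv !inE eqxx ?orbT.
apply/andP/orbitP => [[SK /existsP [f]]|[g _ <-]].
  case/and3P => /dinjectiveP injf /eqP fcov /forall_inP iso.
  have [g Hg] := perm_extend injf.
  exists g => //; apply/eqP; rewrite eqEsubset trE_perm; apply/andP; split.
    apply/subsetP => _ /imsetP [e eI ->].
    have [u [v [euv [uI vI]]]] := edge _ _ IK eI.
    rewrite euv imsetU1 imset_set1 -!Hg //.
    by rewrite -(eqP (forall_inP (iso u uI) v vI)) -euv.
  apply/subsetP => e eS.
  have [a [b [eab [aS bS]]]] := edge _ _ SK eS.
  move: aS bS; rewrite -fcov => /imsetP [u uI au] /imsetP [v vI bv].
  have uvI : [set u; v] \in I.
    by rewrite (eqP (forall_inP (iso u uI) v vI)) -au -bv -eab.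
  apply/imsetP; exists [set u; v] => //.
  by rewrite imsetU1 imset_set1 -!Hg // -au -bv.
split.
  apply/subsetP => _ /imsetP [e eI ->]; rewrite inE card_imset; last exact: perm_inj.
  by have := subsetP IK e eI; rewrite inE.
apply/existsP; exists [ffun x => g x]; apply/and3P; split.
- by apply/dinjectiveP => x y _ _; rewrite !ffunE => /perm_inj.
- apply/eqP/setP => x; apply/imsetP/bigcupP => [[y /bigcupP [e eI ye] ->]|[e']].
    exists (g @: e); first exact: imset_f.
    by rewrite ffunE imset_f.
  case/imsetP => e eI -> /imsetP [y ye ->]; exists y; last by rewrite ffunE.
  exact: mem_cover eI ye.
- apply/forall_inP => u _; apply/forall_inP => v _; rewrite !ffunE.
  have -> : [set g u; g v] = g @: [set u; v] by rewrite imsetU1 imset_set1.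
  by rewrite trE_perm mem_imset //; apply: imset_inj; apply: perm_inj.
Qed.

End GraphCopies.

(** * Probabilities of copies as hitting probabilities *)

Section CopiesProb.
Variables (R : realType) (n : nat).
Implicit Types (A I H S : {set {set 'I_n}}).

Local Notation tr := ((perm_graph n)^* )%act.
Local Notation hit := (hit_prob R (perm_graph n)).

(** Orbit-stabilizer: every copy arises from the same number of permutations, those of one coset of
    the stabilizer. *)
Lemma gmean_copies H (P : pred {set {set 'I_n}}) : H \subset complete 'I_n ->
  gmean (fun g : 'S_n => (P (tr H g))%:R) =
  #|[set S in copies H (complete 'I_n) | P S]|%:R / (num_copies H (complete 'I_n))%:R :> R.
Proof.
move=> HK.
set O := orbit tr setT H.
have OE : copies H (complete 'I_n) = O by apply/setP => S; rewrite graph_iso_orbit.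
rewrite /num_copies OE /gmean.
pose st := #|('C_setT[H | tr])%g|.
have cO : (#|O| * st = #|'S_n|)%N by rewrite card_orbit_stab cardsT.
have fiber S : S \in O ->
    \sum_(g : 'S_n | tr H g == S) (P S)%:R = (st * P S)%:R :> R.
  case/orbitP => h _ <-; rewrite sumr_const -[LHS]mulr_natl -natrM; congr (_ * _)%:R.
  rewrite /st -(card_rcoset _ h); apply: eq_card => g.
  transitivity (tr H g == tr H h); first by [].
  rewrite mem_rcoset !inE sub1set inE actM.
  by rewrite (can2_eq (actKV _ h) (actK _ h)).
have -> : \sum_(g : 'S_n) (P (tr H g))%:R =
    \sum_(S in O) (st * P S)%:R :> R.
  rewrite (partition_big (fun g => tr H g) (mem O)) /=; last first.
    by move=> g _; apply: mem_orbit; rewrite inE.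
  apply: eq_bigr => S SO; rewrite -fiber //.
  by apply: eq_bigr => g /eqP ->.
rewrite -natr_sum -big_distrr /= -cO !natrM.
have -> : (\sum_(S in O) P S = #|[set S in O | P S]|)%N.
  rewrite -sum1_card big_mkcond [RHS]big_mkcond; apply: eq_bigr => S _.
  by rewrite !inE; case: (S \in O) => //=; case: (P S).
have s0 : (st%:R : R) != 0 by rewrite pnatr_eq0 -lt0n cardG_gt0.
have o0 : (#|O|%:R : R) != 0.
  by rewrite pnatr_eq0 -lt0n; apply/card_gt0P; exists H; apply: orbit_refl.
by field; rewrite s0 o0.
Qed.

Lemma hit_prob_self I : I \subset complete 'I_n ->
  hit I I = (num_copies I (complete 'I_n))%:R^-1.
Proof.
move=> IK; rewrite /hit_prob (gmean_copies (fun S => S \subset I) IK).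
suff -> : [set S in copies I (complete 'I_n) | S \subset I] = [set I].
  by rewrite cards1 mul1r.
apply/setP => S; rewrite [LHS]inE graph_iso_orbit // inE.
apply/andP/eqP => [[/orbitP [g _ <-]]|->].
  by move=> sub; apply/eqP; rewrite eqEcard sub card_setact leqnn.
by rewrite orbit_refl.
Qed.

(** Inverting [g] trades a random translate of [A] inside [H] for a random copy of [H] containing
    [A]. *)
Lemma Pr_nu_hit H (HK : H \subset complete 'I_n) A :
  Pr (nu R HK) [pred S : {set {set 'I_n}} | A \subset S] = hit A H.
Proof.
have -> : hit A H = gmean (fun g : 'S_n => (A \subset tr H g)%:R).
  rewrite /hit_prob -[LHS]gmeanV; apply: eq_gmean => g.
  by rewrite -[_ \subset H](trS (perm_graph n) _ _ g) actKV.
rewrite (gmean_copies (fun S => A \subset S) HK) /Pr /= /uniform_mass.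
rewrite -big_mkcondr /= sumr_const -[LHS]mulr_natl; congr (_%:R / _).
by apply: eq_card => S; rewrite [RHS]inE andbC.
Qed.

Lemma qH_ge H I : I \subset H -> I != set0 -> H \subset complete 'I_n ->
  hit I I <= qH R H ^+ #|I|.
Proof.
move=> IH I0 HK; rewrite hit_prob_self ?(subset_trans IH) //.
set N : R := (num_copies _ _)%:R.
have leq : N `^ (- #|I|%:R^-1) <= qH R H.
  by apply: (le_bigmax_cond _ (fun I => (num_copies I (complete 'I_n))%:R `^ _)); rewrite IH.
have -> : N^-1 = (N `^ (- #|I|%:R^-1)) ^+ #|I|.
  rewrite -powR_mulrn ?powR_ge0 // -powRrM mulNr mulVf ?powR_inv1 ?ler0n //.
  by rewrite pnatr_eq0 cards_eq0.
by rewrite lerXn2r ?nnegrE ?powR_ge0 // (le_trans (powR_ge0 _ _) leq).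
Qed.

End CopiesProb.

(** * Passage to natural logarithms and conclusion *)

Lemma trunc_log2_le_ln (R : realType) (m : nat) : (0 < m)%N ->
  (trunc_log 2 m)%:R <= ln (m%:R : R) / ln 2.
Proof.
move=> m0; have ln2 : 0 < ln 2 :> R by rewrite ln_gt0 // ltr1n.
rewrite ler_pdivlMr // mulr_natl -lnXn // ler_ln ?posrE ?exprn_gt0 ?ltr0n //.
by rewrite -natrX ler_nat trunc_logP.
Qed.

Theorem theorem1p1 (R : realType) :
  exists C : R, 0 < C /\
    forall (n : nat) (H : {set {set 'I_n}}) (HK : H \subset complete 'I_n),
      H != set0 ->
      spread (C * qH R H * ln (2 * #|H|%:R)) (nu R HK).
Proof.
have ln2 : 0 < ln 2 :> R by rewrite ln_gt0 // ltr1n.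
have K0 : 0 < 2 * rate_const R ^+ 2 by rewrite mulr_gt0 // exprn_gt0 // rate_const_gt0.
(* Dividing by [ln 2] converts the binary logarithm of [hit_prob_le] into the natural one. *)
exists (2 * rate_const R ^+ 2 / ln 2); split; first exact: divr_gt0.
move=> n H HK H0 A AK A0; rewrite Pr_nu_hit.
have hq (I : {set {set 'I_n}}) : I \subset H -> I != set0 ->
    hit_prob R (perm_graph n) I I <= qH R H ^+ #|I| by move=> *; apply: qH_ge.
have q0 : 0 < qH R H.
  have q_ge0 : 0 <= qH R H by apply: bigmax_ge_id.
  rewrite lt_neqAle q_ge0 andbT eq_sym; apply/eqP => e.
  have := hq H (subxx _) H0; rewrite e expr0n cards_eq0 (negbTE H0) /=.
  by rewrite leNgt hit_prob_refl_gt0.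
apply: le_trans (hit_prob_le H0 q0 hq A) _.
have K_ge0 := ltW K0; have q_ge0 := ltW q0.
have t_ge0 : 0 <= (trunc_log 2 (2 * #|H|))%:R :> R := ler0n _ _.
have le_t : (trunc_log 2 (2 * #|H|))%:R <= ln (2 * #|H|%:R) / ln 2 :> R.
  by have := @trunc_log2_le_ln R (2 * #|H|); rewrite natrM muln_gt0 card_gt0 H0; apply.
set t : R := _%:R in t_ge0 le_t *; set k := 2 * _ in K0 K_ge0 *.
have le_kt : k * t * qH R H <= k / ln 2 * qH R H * ln (2 * #|H|%:R).
  have -> : k / ln 2 * qH R H * ln (2 * #|H|%:R) = k * (ln (2 * #|H|%:R) / ln 2) * qH R H.
    by ring.
  by apply: ler_wpM2r => //; apply: ler_wpM2l.
have kt_ge0 : 0 <= k * t * qH R H by apply: mulr_ge0 => //; apply: mulr_ge0.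
by apply: lerXn2r; rewrite ?nnegrE // (le_trans kt_ge0 le_kt).
Qed.
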